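(* Consider the linear network $x(t+1)=Ax(t)+Bu(t)$ with block-diagonal feedback gain $K$, $A_K=A+BK$, $W_i(\xi_i)=\xi_i^\top P_i\xi_i$ with $P_i=P_i^\top\succ0$, and $M\in\mathbb N$, as in the context. Let $c_{ij}(M)=\|P_i^{1/2}\Phi_{ij}(M)P_j^{-1/2}\|_2$, $\mathcal J_i=\{j:c_{ij}(M)>0\}$, let $a_{ij}>0$ for $j\in\mathcal J_i$ satisfy $$\sum_{j\in\mathcal J_i}\frac{c_{ij}(M)}{\sqrt{a_{ij}}}\le1,\qquad i=1,\dots,\ell,$$ and put $a_{ij}=0$ for $j\notin\mathcal J_i$, $\gamma_{ij}(s)=a_{ij}s$. Then, for every $\xi\in\mathbb R^n$, $$W_i\bigl(x_i(M,\xi,q)\bigr)\le\max_{j=1,\dots,\ell}\gamma_{ij}\bigl(W_j(\xi_j)\bigr),\qquad i=1,\dots,\ell,$$ where $x(l,\xi,q)=A_K^l\xi$ is the trajectory generated from $\xi$ by the finite-step feedback sequence $q(\xi)=(K\xi,KA_K\xi,\dots,KA_K^{M-1}\xi)$.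
   Context: $x=(x_1,\dots,x_\ell)\in\mathbb R^n$ with blocks $x_i\in\mathbb R^{n_i}$, $A=[A_{ij}]_{i,j=1}^\ell$, $B=\operatorname{blkdiag}(B_1,\dots,B_\ell)$, $K=\operatorname{blkdiag}(K_1,\dots,K_\ell)$. $A_K^M=[\Phi_{ij}(M)]_{i,j=1}^\ell$ is the block partition of the $M$-th power. $P^{1/2}$ is the principal (symmetric positive definite) square root and $P^{-1/2}=(P^{1/2})^{-1}$; $\|\cdot\|_2$ is the spectral norm. *)

(* Defs.v *)
From HB Require Import structures.
From mathcomp Require Import all_boot all_order all_algebra.
From mathcomp Require Import boolp classical_sets reals.

Set Implicit Arguments.
Unset Strict Implicit.
Unset Printing Implicit Defensive.

Import Order.TTheory GRing.Theory Num.Theory.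
Local Open Scope ring_scope.

(* Rectangular version of \mxdiag: diagonal blocks n_i x m_i.  On the diagonal
   the dimensions agree, so conform_mx returns D i itself. *)
Definition blkdiag (R : realType) (l : nat) (n m : 'I_l -> nat)
    (D : forall i, 'M[R]_(n i, m i)) : 'M[R]_(\sum_i n i, \sum_i m i) :=
  \mxblock_(i, j) (if i == j then conform_mx 0 (D i) else 0).

Definition qform (R : realType) (k : nat) (P : 'M[R]_k) (x : 'cV[R]_k) : R :=
  (x^T *m P *m x) 0 0.

Definition posdef (R : realType) (k : nat) (P : 'M[R]_k) : Prop :=
  P^T = P /\ forall x : 'cV[R]_k, x != 0 -> 0 < qform P x.

(* The symmetric positive definite S with S^2 = P, which exists and is unique
   when P is positive definite; the default value 0 is then irrelevant. *)
Definition sqrtmx (R : realType) (k : nat) (P : 'M[R]_k) : 'M[R]_k :=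
  xget 0 [set S | posdef S /\ S *m S = P]%classic.

Definition enorm (R : realType) (k : nat) (x : 'cV[R]_k) : R :=
  Num.sqrt (\sum_i x i 0 ^+ 2).

(* Operator norm induced by the Euclidean norms; the set is nonempty and
   bounded, so sup is its least upper bound. *)
Definition specnorm (R : realType) (p q : nat) (A : 'M[R]_(p, q)) : R :=
  sup [set enorm (A *m x) | x in [set x : 'cV[R]_q | enorm x <= 1]]%classic.

(* State reached after t steps of x(t+1) = A x(t) + B u(t) from xi, under the
   finite input sequence u; meaningful for t <= size u. *)
Definition traj (R : realType) (n m : nat) (A : 'M[R]_n) (B : 'M[R]_(n, m))
    (t : nat) (xi : 'cV[R]_n) (u : seq 'cV[R]_m) : 'cV[R]_n :=
  foldl (fun x v => A *m x + B *m v) xi (take t u).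

Definition closed_loop (R : realType) (n m : nat) (A : 'M[R]_n)
    (B : 'M[R]_(n, m)) (K : 'M[R]_(m, n)) : 'M[R]_n := A + B *m K.

Definition feedback_seq (R : realType) (n m : nat) (A : 'M[R]_n)
    (B : 'M[R]_(n, m)) (K : 'M[R]_(m, n)) (M : nat) (xi : 'cV[R]_n) :
    M.-tuple 'cV[R]_m :=
  [tuple K *m (closed_loop A B K ^+ t *m xi) | t < M].

Definition coupling (R : realType) (l : nat) (n : 'I_l -> nat)
    (P : forall i, 'M[R]_(n i)) (Phi : 'M[R]_(\sum_i n i)) (i j : 'I_l) : R :=
  specnorm (sqrtmx (P i) *m submxblock Phi i j *m invmx (sqrtmx (P j))).

Definition lin_gain (R : realType) (l : nat) (a : 'I_l -> 'I_l -> R)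
    (i j : 'I_l) (s : R) : R := a i j * s.

(* Main.v *)
(* In the coordinates y_j = P_j^(1/2) xi_j one has W_j(xi_j) = |y_j|^2, and the
   state after M steps satisfies
     |P_i^(1/2) x_i(M)| <= \sum_j c_ij |y_j|
                        = \sum_(j in J_i) (c_ij / sqrt a_ij) * sqrt (a_ij W_j(xi_j)),
   a combination with weights of total at most 1 of numbers below
   sqrt (max_j a_ij W_j(xi_j)).  The square root of a positive definite matrix P
   is a polynomial in P, so that the spectral theorem over the complex numbers
   suffices for its existence over the reals. *)
Require Import Defs.
From HB Require Import structures.
From mathcomp Require Import all_boot all_order all_algebra.
From mathcomp Require Import boolp classical_sets reals.
From mathcomp Require Import complex ring.

Set Implicit Arguments.
Unset Strict Implicit.
Unset Printing Implicit Defensive.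

Import Order.TTheory GRing.Theory Num.Theory.
Local Open Scope ring_scope.


(** * Polynomials: interpolation and evaluation at a matrix *)

(** Newton's scheme: the value at a new node [y] is corrected by a multiple of the product of the
    ['X - z%:P] over the earlier nodes, which vanishes at all of them but not at [y]. *)
Lemma horner_interpolation (F : fieldType) (s : seq F) (f : F -> F) :
  exists p : {poly F}, {in s, forall x, p.[x] = f x}.
Proof.
elim: s => [|y s [p hp]]; first by exists 0.
have [ys|ys] := boolP (y \in s).
  by exists p => x; rewrite inE => /predU1P[->|]; exact: hp.
pose w := \prod_(z <- s) ('X - z%:P).
have wy : w.[y] != 0 by rewrite -/(root w y) root_prod_XsubC.
exists (p + ((f y - p.[y]) / w.[y])%:P * w) => x.
rewrite inE !hornerE => /predU1P[->|xs].
  by rewrite divfK // addrC subrK.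
have /rootP -> : root w x by rewrite root_prod_XsubC.
by rewrite mulr0 addr0 hp.
Qed.

(** Used to see that a polynomial in a symmetric matrix is symmetric. *)
Lemma trmx_horner (R : comNzRingType) (k : nat) (P : 'M[R]_k.+1) (p : {poly R}) :
  (horner_mx P p)^T = horner_mx P^T p.
Proof.
elim/poly_ind: p => [|p c IH]; first by rewrite !rmorph0 trmx0.
rewrite !rmorphD !rmorphM /= !horner_mx_X !horner_mx_C linearD /= tr_scalar_mx.
by rewrite trmx_mul IH; congr (_ + _); apply: comm_mx_horner.
Qed.

Section Euclidean.
Variable R : realType.
Implicit Types k p q : nat.

(** * Euclidean norm and spectral norm *)

Lemma enorm_ge0 k (x : 'cV[R]_k) : 0 <= enorm x.
Proof. exact: sqrtr_ge0. Qed.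

Lemma sqr_enorm k (x : 'cV[R]_k) : enorm x ^+ 2 = \sum_i x i 0 ^+ 2.
Proof. by rewrite sqr_sqrtr // sumr_ge0 // => i _; exact: sqr_ge0. Qed.

Lemma enorm_eq0 k (x : 'cV[R]_k) : (enorm x == 0) = (x == 0).
Proof.
rewrite -[LHS]sqrf_eq0 sqr_enorm psumr_eq0 => [|i _]; last exact: sqr_ge0.
apply/allP/eqP => [h|-> i _]; last by rewrite mxE expr0n eqxx.
apply/matrixP => i j; rewrite ord1 mxE; apply/eqP.
by rewrite -sqrf_eq0; apply: h; rewrite mem_index_enum.
Qed.

Lemma enorm0 k : enorm (0 : 'cV[R]_k) = 0.
Proof. by apply/eqP; rewrite enorm_eq0. Qed.

Lemma enormZ k (t : R) (x : 'cV[R]_k) : enorm (t *: x) = `|t| * enorm x.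
Proof.
rewrite -sqrtr_sqr -sqrtrM ?sqr_ge0 // mulr_sumr; congr Num.sqrt.
by apply: eq_bigr => i _; rewrite mxE exprMn.
Qed.

Lemma CauchySchwarz_enorm k (x y : 'cV[R]_k) :
  \sum_i x i 0 * y i 0 <= enorm x * enorm y.
Proof.
have [->|x0] := eqVneq x 0.
  by rewrite enorm0 mul0r big1 // => i _; rewrite mxE mul0r.
have [->|y0] := eqVneq y 0.
  by rewrite enorm0 mulr0 big1 // => i _; rewrite mxE mulr0.
have xy_gt0 : 0 < enorm x * enorm y.
  by rewrite mulr_gt0 // lt_def enorm_eq0 ?x0 ?y0 enorm_ge0.
(* Expanding this sum gives twice |x||y| (|x||y| - <x, y>); dividing by |x||y| requires both vectors
   to be nonzero. *)
have : 0 <= \sum_i (enorm y * x i 0 - enorm x * y i 0) ^+ 2.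
  by apply: sumr_ge0 => i _; exact: sqr_ge0.
have -> : \sum_i (enorm y * x i 0 - enorm x * y i 0) ^+ 2 =
    enorm y ^+ 2 * (\sum_i x i 0 ^+ 2) + enorm x ^+ 2 * (\sum_i y i 0 ^+ 2)
    - (enorm x * enorm y) * (\sum_i x i 0 * y i 0) *+ 2.
  rewrite !mulr_sumr -sumrMnl -big_split -sumrB /=.
  by apply: eq_bigr => i _; ring.
rewrite -!sqr_enorm.
have -> : enorm y ^+ 2 * enorm x ^+ 2 + enorm x ^+ 2 * enorm y ^+ 2 =
  (enorm x * enorm y) * (enorm x * enorm y) *+ 2 by ring.
by rewrite subr_ge0 lerMn2r /= ler_pM2l.
Qed.

Lemma enormD k (x y : 'cV[R]_k) : enorm (x + y) <= enorm x + enorm y.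
Proof.
rewrite -(@ler_pXn2r _ 2) ?nnegrE ?addr_ge0 ?enorm_ge0 //.
rewrite sqrrD !sqr_enorm.
have -> : \sum_i (x + y) i 0 ^+ 2 =
    \sum_i x i 0 ^+ 2 + (\sum_i x i 0 * y i 0) *+ 2 + \sum_i y i 0 ^+ 2.
  rewrite -sumrMnl -!big_split /=.
  by apply: eq_bigr => i _; rewrite mxE sqrrD.
by rewrite lerD2r lerD2l lerMn2r /= CauchySchwarz_enorm.
Qed.

Lemma enorm_sum k (I : finType) (F : I -> 'cV[R]_k) :
  enorm (\sum_i F i) <= \sum_i enorm (F i).
Proof.
elim/big_rec2: _ => [|i b x _ le_xb]; first by rewrite enorm0.
by apply: le_trans (enormD _ _) _; rewrite lerD2l.
Qed.

Lemma ler_norm_enorm k (x : 'cV[R]_k) i : `|x i 0| <= enorm x.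
Proof.
rewrite -sqrtr_sqr; apply: ler_wsqrtr.
by rewrite (bigD1 i) //= lerDl sumr_ge0 // => j _; exact: sqr_ge0.
Qed.

(** A vector of norm at most 1 has entries at most 1 in absolute value, so the norms of the columns
    of [A] add up to a bound. This makes the [sup] in [specnorm] a genuine least upper bound. *)
Lemma specnorm_has_ubound p q (A : 'M[R]_(p, q)) :
  has_ubound [set enorm (A *m x) | x in [set x : 'cV[R]_q | enorm x <= 1]]%classic.
Proof.
exists (\sum_j enorm (col j A)) => _ [x /= x1 <-].
have -> : A *m x = \sum_j x j 0 *: col j A.
  apply/matrixP => i j; rewrite ord1 mxE summxE.
  by apply: eq_bigr => h _; rewrite !mxE mulrC.
apply: le_trans (enorm_sum _) _; apply: ler_sum => j _.
rewrite enormZ ler_piMl ?enorm_ge0 //.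
exact: le_trans (ler_norm_enorm _ _) x1.
Qed.

Lemma specnorm_ge0 p q (A : 'M[R]_(p, q)) : 0 <= specnorm A.
Proof.
apply: ub_le_sup; first exact: specnorm_has_ubound.
by exists 0; rewrite /= ?mulmx0 enorm0.
Qed.

Lemma enorm_mulmx p q (A : 'M[R]_(p, q)) (x : 'cV[R]_q) :
  enorm (A *m x) <= specnorm A * enorm x.
Proof.
have [->|x0] := eqVneq x 0; first by rewrite mulmx0 !enorm0 mulr0.
have ex_gt0 : 0 < enorm x by rewrite lt_def enorm_eq0 x0 enorm_ge0.
rewrite -ler_pdivrMr // mulrC.
have -> : (enorm x)^-1 * enorm (A *m x) = enorm (A *m ((enorm x)^-1 *: x)).
  by rewrite -scalemxAr enormZ ger0_norm // invr_ge0 ltW.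
apply: ub_le_sup; first exact: specnorm_has_ubound.
exists ((enorm x)^-1 *: x) => //=.
by rewrite enormZ ger0_norm ?mulVf ?gt_eqF // invr_ge0 ltW.
Qed.

(** * Positive definite matrices and their square roots *)

Lemma qform_sqr k (S : 'M[R]_k) (x : 'cV[R]_k) :
  S^T = S -> qform (S *m S) x = enorm (S *m x) ^+ 2.
Proof.
move=> symS; rewrite sqr_enorm /qform mulmxA -mulmxA.
by rewrite -{1}symS -trmx_mul mxE; apply: eq_bigr => i _; rewrite mxE.
Qed.

Lemma posdef_unitmx k (P : 'M[R]_k) : posdef P -> P \in unitmx.
Proof.
move=> [_ posP]; rewrite unitmxE unitfE; apply/det0P => -[v v0 vP].
by have := posP v^T; rewrite trmx_eq0 /qform trmxK vP mul0mx mxE ltxx => /(_ v0).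
Qed.

(* The sequence s lists the eigenvalues of P, which is diagonalized over the
   complex numbers. *)
Lemma posdef_annihilator k (P : 'M[R]_k.+1) : posdef P ->
  exists2 s : seq R, {in s, forall r, 0 < r} &
    forall p : {poly R}, {in s, forall r, p.[r] = 0} -> horner_mx P p = 0.
Proof.
move=> [symP posP]; pose f := real_complex R; pose A := map_mx f P.
have hermA : A \is hermsymmx.
  apply: realsym_hermsym.
    by apply/is_hermitianmxP; rewrite expr0 scale1r map_mx_id // map_trmx symP.
  by apply/mxOverP => i j; rewrite !mxE complex_real.
have [U uU [d dreal Aeq]] : exists2 U, U \in unitmx &
    exists2 d, d \is a mxOver Num.real & A = invmx U *m diag_mx d *m U.
  exists (spectralmx A); first exact: spectral_unit.
  exists (spectral_diag A); first exact: hermitian_spectral_diag_real.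
  exact/orthomx_spectralP/hermitian_normalmx.
pose r j := complex.Re (d 0 j).
have dE j : d 0 j = f (r j) by rewrite [RHS]RRe_real //; apply/mxOverP.
exists [seq r j | j <- enum 'I_k.+1].
  move=> _ /mapP[j _ ->].
  have : eigenvalue A (f (r j)).
    apply/eigenvalueP; exists (row j U).
      rewrite Aeq !mulmxA -row_mul mulmxV // row1 -rowE row_diag_mx -dE.
      by rewrite -scalemxAl -rowE.
    (* A zero row of [U] would put 0 on the diagonal of U U^-1 = 1. *)
    apply/eqP => row0; have /matrixP/(_ j j) := mulmxV uU.
    have -> : (U *m invmx U) j j = (row j U *m invmx U) 0 j.
      by rewrite -row_mul [RHS]mxE.
    by rewrite row0 mul0mx !mxE eqxx => /eqP; rewrite eq_sym oner_eq0.
  (* The characteristic polynomial of [A] is the image of that of [P], so [r j] is an eigenvalue of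
     [P] over the reals. A real eigenvector v gives 0 < v P v^T = r_j |v|^2. *)
  rewrite eigenvalue_root_char -map_char_poly fmorph_root -eigenvalue_root_char.
  case/eigenvalueP => v vP v0.
  have := posP v^T; rewrite trmx_eq0 => /(_ v0).
  rewrite /qform trmxK vP -scalemxAl mxE pmulr_lgt0 //.
  have -> : (v *m v^T) 0 0 = enorm v^T ^+ 2.
    by rewrite sqr_enorm mxE; apply: eq_bigr => i _; rewrite !mxE.
  by rewrite exprn_gt0 // lt_def enorm_eq0 trmx_eq0 v0 enorm_ge0.
(* Over the complex numbers p(P) is conjugate to the diagonal matrix of the p(r_j), all zero. *)
move=> p hp; apply: (map_mx_inj (f := f)); rewrite map_horner_mx -/A.
rewrite Aeq map_mx0 horner_mx_uconjC // horner_mx_diag.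
suff -> : map_mx (horner (map_poly f p)) d = 0.
  by rewrite linear0 mulmx0 mul0mx.
apply/matrixP => i j; rewrite !mxE ord1 dE horner_map hp ?rmorph0 //.
by apply/mapP; exists j; rewrite ?mem_enum.
Qed.

(* With T a polynomial in P interpolating the fourth root on the spectrum,
   S = T^2 satisfies S^2 = P, and its form |T x|^2 is positive. *)
Lemma posdef_sqrt_exists k (P : 'M[R]_k) : posdef P ->
  exists S, posdef S /\ S *m S = P.
Proof.
case: k P => [|k] P posP.
  by exists P; split=> //; rewrite flatmx0 [RHS]flatmx0.
have [s s_gt0 annP] := posdef_annihilator posP.
have [p hp] := horner_interpolation s (fun r => Num.sqrt (Num.sqrt r)).
pose T := horner_mx P p.
have symT : T^T = T by rewrite trmx_horner (proj1 posP).
have T4 : (T *m T) *m (T *m T) = P.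
  apply/eqP; rewrite -subr_eq0; apply/eqP.
  (* On the spectrum p is the fourth root, so p^4 - X vanishes there and annihilates [P]. *)
  have := annP (p ^+ 2 ^+ 2 - 'X).
  rewrite rmorphB !rmorphXn /= horner_mx_X; apply=> r rs.
  rewrite !(hornerD, hornerN, hornerX, horner_exp) hp //.
  by rewrite !sqr_sqrtr ?sqrtr_ge0 ?subrr // ltW // s_gt0.
exists (T *m T); split=> //; split; first by rewrite trmx_mul symT.
move=> x x0; rewrite qform_sqr // exprn_gt0 // lt_def enorm_ge0 andbT enorm_eq0.
(* If T x = 0 then P x = T^4 x = 0, and [P] is invertible. *)
apply/eqP => Tx0; have /eqP := x0; apply.
by rewrite -[x](mulKmx (posdef_unitmx posP)) -T4 -!mulmxA Tx0 !mulmx0.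
Qed.

Lemma sqrtmxP k (P : 'M[R]_k) :
  posdef P -> posdef (sqrtmx P) /\ sqrtmx P *m sqrtmx P = P.
Proof. by move=> /posdef_sqrt_exists; exact: xgetPex. Qed.

Lemma qform_sqrtmx k (P : 'M[R]_k) (x : 'cV[R]_k) :
  posdef P -> qform P x = enorm (sqrtmx P *m x) ^+ 2.
Proof. by move=> /sqrtmxP[[symS _] SS]; rewrite -qform_sqr ?SS. Qed.

(** * Trajectories and blocks *)

Lemma traj_feedback n m (A : 'M[R]_n) (B : 'M[R]_(n, m)) (K : 'M[R]_(m, n))
    (M : nat) (xi : 'cV[R]_n) (t : nat) : (t <= M)%N ->
  traj A B t xi (feedback_seq A B K M xi) = closed_loop A B K ^+ t *m xi.
Proof.
elim: t => [|t IH] tM; first by rewrite /traj take0 expr0 mul1mx.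
(* The default 0 is never read, since t < M. *)
rewrite /traj (take_nth 0) ?size_tuple // foldl_rcons -/(traj _ _ _ _ _).
rewrite IH ?(ltnW tM) // exprS -[_ * _]/(_ *m _) -mulmxA.
have -> : nth 0 (feedback_seq A B K M xi) t =
    K *m (closed_loop A B K ^+ t *m xi).
  by rewrite -[t]/(val (Ordinal tM)) -tnth_nth tnth_mktuple.
by rewrite [in RHS]/closed_loop mulmxDl !mulmxA.
Qed.

Lemma submxcol_mulmx (l : nat) (n : 'I_l -> nat)
    (Phi : 'M[R]_(\sum_i n i)) (x : 'cV[R]_(\sum_i n i)) (i : 'I_l) :
  submxcol (Phi *m x) i = \sum_j submxblock Phi i j *m submxcol x j.
Proof.
rewrite -submxcol_mul -[x in LHS]submxcolK.
rewrite -[submxcol Phi i]submxrowK mul_mxrow_mxcol.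
by apply: eq_bigr => j _; rewrite submxblockEv.
Qed.

(** Insert P_j^(-1/2) P_j^(1/2) between each block of [Phi] and x_j, then use the triangle
    inequality and the operator norm bound. *)
Lemma coupling_bound (l : nat) (n : 'I_l -> nat) (P : forall i, 'M[R]_(n i))
    (Phi : 'M[R]_(\sum_i n i)) (x : 'cV[R]_(\sum_i n i)) (i : 'I_l) :
  (forall i, posdef (P i)) ->
  enorm (sqrtmx (P i) *m submxcol (Phi *m x) i) <=
  \sum_j coupling P Phi i j * enorm (sqrtmx (P j) *m submxcol x j).
Proof.
move=> posP; rewrite submxcol_mulmx mulmx_sumr.
apply: le_trans (enorm_sum _) _; apply: ler_sum => j _.
apply: le_trans (enorm_mulmx _ _).
by rewrite !mulmxA mulmxKV // posdef_unitmx //; case: (sqrtmxP (posP j)).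
Qed.

End Euclidean.

(* The maximum is taken with base value 0, which is harmless because every
   term is nonnegative. *)
Theorem theorem2 (R : realType) (l : nat) (n m : 'I_l -> nat)
    (A : 'M[R]_(\sum_i n i))
    (Bd : forall i : 'I_l, 'M[R]_(n i, m i))
    (Kd : forall i : 'I_l, 'M[R]_(m i, n i))
    (P : forall i : 'I_l, 'M[R]_(n i))
    (hP : forall i, posdef (P i))
    (M : nat)
    (a : 'I_l -> 'I_l -> R) :
  let B := blkdiag Bd in
  let K := blkdiag Kd in
  let AK := closed_loop A B K in
  let c := coupling P (AK ^+ M) in
  let J := fun i : 'I_l => [set j : 'I_l | 0 < c i j]%SET in
  (forall i j, j \in J i -> 0 < a i j) ->
  (forall i j, j \notin J i -> a i j = 0) ->
  (forall i, \sum_(j in J i) c i j / Num.sqrt (a i j) <= 1) ->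
  forall xi : 'cV[R]_(\sum_i n i),
    let q := feedback_seq A B K M xi in
    (forall t : nat, (t <= M)%N -> traj A B t xi q = AK ^+ t *m xi) /\
    (forall i : 'I_l,
       qform (P i) (submxcol (traj A B M xi q) i)
       <= \big[Num.max/0]_(j < l)
            lin_gain a i j (qform (P j) (submxcol xi j))).
Proof.
move=> B K AK c J a_gt0 a_eq0 sum_le1 xi q.
split=> [t tM|i]; first exact: traj_feedback.
rewrite traj_feedback // -/AK qform_sqrtmx //.
set w := \big[Num.max/0]_(j < l) _.
have c_ge0 j : 0 <= c i j by exact: specnorm_ge0.
have w_ge0 : 0 <= w by exact: bigmax_ge_id.
(* Both sides are now squares of nonnegative numbers, so it suffices to compare the norm with the
   square root of [w]. *)
rewrite -[leRHS](sqr_sqrtr w_ge0) ler_pXn2r ?nnegrE ?enorm_ge0 ?sqrtr_ge0 //.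
apply: le_trans (coupling_bound _ _ _ hP) _; rewrite -/c.
apply: (@le_trans _ _ (\sum_(j in J i) c i j / Num.sqrt (a i j) * Num.sqrt w));
  last by rewrite -mulr_suml ler_piMl ?sqrtr_ge0 ?sum_le1.
rewrite [leRHS]big_mkcond; apply: ler_sum => j _.
case: ifPn => [jJ|]; last first.
  (* Outside [J i] the coupling is 0, so these terms drop out of the sum. *)
  rewrite inE -leNgt => c_le0.
  by rewrite (@le_anti _ _ (c i j) 0) ?mul0r // c_le0 c_ge0.
have aij := a_gt0 _ _ jJ.
rewrite -mulrA ler_wpM2l // ler_pdivlMl ?sqrtr_gt0 //.
(* Moving sqrt a_ij under the root turns the left side into the root of a_ij W_j(xi_j), one of the
   terms of the maximum. *)
rewrite -(ger0_norm (enorm_ge0 _)) -sqrtr_sqr -sqrtrM ?(ltW aij) //.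
rewrite -qform_sqrtmx //; apply: ler_wsqrtr.
exact: (le_bigmax _ (fun j => lin_gain a i j (qform (P j) (submxcol xi j)))).
Qed.
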